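(* Let $X\subset\mathcal{A}^{\mathbb{Z}^d}$ be a subshift, $(X,\phi)$ a cellular automaton and $\mu$ a Borel probability measure on $X$ such that $(X,\phi)$ is $\mu$-LEP. Then the sequence of measures $\mu_n^c:=\frac1n\sum_{i=1}^n\phi^i\mu$ converges weakly to a $\phi$-LP Borel probability measure $\mu_\infty$.
   Context: $\mathcal{A}$ is a finite alphabet, $d\ge1$, and $\mathbb{N}$ includes $0$. $\mathcal{A}^{\mathbb{Z}^d}$ has the product topology and shift maps $\sigma_i$, $(\sigma_i x)_j=x_{i+j}$ for $i,j\in\mathbb{Z}^d$. A subshift is a closed subset $X\subset\mathcal{A}^{\mathbb{Z}^d}$ invariant under all $\sigma_i$. A cellular automaton (CA) $(X,\phi)$ is a subshift $X$ with a continuous map $\phi:X\to X$ commuting with all shifts $\sigma_i$. $\phi^i\mu$ denotes the push-forward of $\mu$ under $\phi^i$. Weak convergence $\mu_n\to\mu_\infty$ means $\int f\,d\mu_n\to\int f\,d\mu_\infty$ for all continuous $f:X\to\mathbb{R}$. Let $W_m=[-m,m]^d\cap\mathbb{Z}^d$ and let $x_{W_m}$ be the restriction of $x$ to $W_m$. $LEP(\phi)$ (resp. $LP(\phi)$) is the set of $x\in X$ such that for every $m\in\mathbb{N}$ the sequence $i\mapsto(\phi^i x)_{W_m}$, $i\ge 0$, is eventually periodic (resp. periodic). For a Borel probability measure $\nu$ on $X$, $(X,\phi)$ is $\nu$-LEP (equivalently, $\nu$ is $\phi$-LEP) if $\nu(LEP(\phi))=1$, and $(X,\phi)$ is $\nu$-LP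 (equivalently, $\nu$ is $\phi$-LP) if $\nu(LP(\phi))=1$. *)

(* Defs.v *)
From HB Require Import structures.
From mathcomp Require Import all_boot all_order all_algebra.
From mathcomp Require Import all_classical all_reals all_analysis.

Set Implicit Arguments.
Unset Strict Implicit.
Unset Printing Implicit Defensive.

Import Order.TTheory GRing.Theory Num.Theory.
Import numFieldNormedType.Exports.

Local Open Scope classical_set_scope.
Local Open Scope ring_scope.

(* Z^d is 'rV[int]_d, with its coordinatewise addition. *)
Definition config (A : finType) (d : nat) :=
  {ptws 'rV[int]_d -> discrete_topology A}.

Definition shift (A : finType) (d : nat) (i : 'rV[int]_d) (x : config A d) :
    config A d :=
  fun j => x (i + j).

Record subshift (A : finType) (d : nat) := Subshift {
  subshift_set :> set (config A d);
  subshift_closed : closed subshift_set;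
  subshift_shift : forall i x, subshift_set x -> subshift_set (shift i x)
}.

(* As a type, a subshift X is the sigma type of its elements, which carries the
   topology induced by config A d. *)
Definition subshift_shift_map (A : finType) (d : nat) (X : subshift A d)
    (i : 'rV[int]_d) (x : X) : X :=
  SigSub (mem_set (subshift_shift i (set_valP x))).

Definition cellular_automaton (A : finType) (d : nat) (X : subshift A d)
    (phi : X -> X) : Prop :=
  continuous phi /\
  forall i x, phi (subshift_shift_map i x) = subshift_shift_map i (phi x).

Definition periodic {T : Type} (u : nat -> T) : Prop :=
  exists2 p, (0 < p)%N & forall i, u (i + p)%N = u i.

Definition eventually_periodic {T : Type} (u : nat -> T) : Prop :=
  exists N, periodic (fun i => u (N + i)%N).

Definition window (d m : nat) : set 'rV[int]_d :=
  [set j | forall k, `|j ord0 k| <= m%:Z].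
Arguments window : clear implicits.

Definition window_restr (A : finType) (d m : nat) (x : config A d) :
    window d m -> A :=
  fun j => x (set_val j).

Definition LEP (A : finType) (d : nat) (X : subshift A d) (phi : X -> X) :
    set X :=
  [set x | forall m, eventually_periodic
     (fun i => window_restr (m := m) (set_val (iter i phi x)))].

Definition LP (A : finType) (d : nat) (X : subshift A d) (phi : X -> X) :
    set X :=
  [set x | forall m, periodic
     (fun i => window_restr (m := m) (set_val (iter i phi x)))].

(* Measurable types are required to be pointed, whence the argument X0 in the
   two types below; it is no restriction, as an empty subshift carries no
   probability measure. *)
Definition psubshift (A : finType) (d : nat) (X : subshift A d)
  (X0 : X !=set0) : Type := X.

Section psubshift_instances.
Context (A : finType) (d : nat) (X : subshift A d) (X0 : X !=set0).

HB.instance Definition _ := Topological.copy (psubshift X0) X.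

HB.instance Definition _ := isPointed.Build (psubshift X0)
  (SigSub (mem_set (projT2 (cid X0)))).

End psubshift_instances.

Definition borel (A : finType) (d : nat) (X : subshift A d) (X0 : X !=set0) :=
  g_sigma_algebraType (@open (psubshift X0)).

Section measures.
Context (R : realType) (A : finType) (d : nat) (X : subshift A d).
Context (X0 : X !=set0).
Implicit Types (phi : X -> X) (mu : set (borel X0) -> \bar R).

Definition measure_LEP phi mu : Prop := mu (LEP phi) = 1%E.

Definition measure_LP phi mu : Prop := mu (LP phi) = 1%E.

Definition cesaro_measure phi mu (n : nat) : set (borel X0) -> \bar R :=
  fun B => ((n%:R^-1)%:E *
    \sum_(1 <= i < n.+1) pushforward mu (iter i phi : borel X0 -> borel X0) B)%E.

Definition weak_cvg (mu_ : nat -> set (borel X0) -> \bar R) mu : Prop :=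
  forall f : X -> R, continuous f ->
    (\int[mu_ n]_x (f x)%:E)%E @[n --> \oo] --> (\int[mu]_x (f x)%:E)%E.

End measures.

(* Main.v *)
(* For x in LEP(phi) and t in [0, 1], let n_k(t) be integers that are uniform
   on [0, k!) for t uniform and satisfy n_l(t) = n_k(t) mod k! for k <= l. As
   the window contents along the orbit of x are eventually periodic, with some
   period dividing k! for k large, phi^(k! + n_k(t)) x converges to a point
   T(x, t), and T(x, t) lies in LP(phi). The limit measure is the image of
   mu x Lebesgue under T: conditionally on x, T(x, .) follows the uniform
   measure on the odometer towards which the orbit of x is attracted. For a
   continuous f, the sequence f(phi^i x) is asymptotically almost periodic, so
   its averages over windows of length n converge uniformly in the position of
   the window; the windows [1, n] give the Cesaro means of mu, the windows
   [k!, 2 k!) give the integral of f against the law of phi^(k! + n_k(t)) x, and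
   dominated convergence identifies both limits. *)

Require Import Defs.
From mathcomp Require Import all_boot all_order all_algebra.
From mathcomp Require Import all_classical all_reals all_analysis.
From mathcomp Require Import measurable_realfun lra zify.

Set Implicit Arguments.
Unset Strict Implicit.
Unset Printing Implicit Defensive.

Import Order.TTheory GRing.Theory Num.Theory.
Import numFieldNormedType.Exports.

Local Open Scope classical_set_scope.
Local Open Scope ring_scope.

(** * The topology of a subshift *)

Section subshift_topology.
Context (A : finType) (d : nat) (X : subshift A d).

(** Cylinders are indexed through the enumeration [pickle] of the sites rather than through windows:
    raising [m] by one adds at most one coordinate. *)
Definition agree (m : nat) (x y : X) : Prop :=
  forall j : 'rV[int]_d, (pickle j < m)%N -> set_val x j = set_val y j.

Lemma agree_le m n x y : (m <= n)%N -> agree n x y -> agree m x y.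
Proof. by move=> mn xy j jm; apply: xy; exact: leq_trans mn. Qed.

(** The filter generated by the cylinders around [x] fixes each coordinate eventually, hence
    converges to [x] in the product topology. *)
Lemma agree_sub_nbhs (x : X) (U : set X) :
  nbhs x U -> exists m, [set y | agree m x y] `<=` U.
Proof.
move=> xU.
pose F := filter_from [set: nat] (fun m => [set y : X | agree m x y]).
have FF : Filter F.
  apply: filter_from_filter; first by exists 0%N.
  move=> m n _ _; exists (maxn m n) => // y xy.
  by split; apply: agree_le xy; rewrite ?leq_maxl ?leq_maxr.
suff Fx : F --> x by have [m _ mU] := Fx _ xU; exists m.
move=> V [/= W [[W' oW' <-] W'x] WV].
have cvgF : (set_val @ F) --> (set_val x : config A d).
  apply/cvg_sup => j V' [/= _ [[B _ <-] Bx BV']].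
  exists (pickle j).+1 => // y xy.
  suff : B (set_val y j) by move/BV'.
  by rewrite -xy.
have [m _ mW] := cvgF W' (open_nbhs_nbhs (conj oW' W'x)).
by exists m => // y /mW W'y; exact: WV.
Qed.

Lemma open_coord j a : open [set x : X | set_val x j = a].
Proof.
exists [set x : config A d | x j = a] => //.
have pc : continuous (proj j : config A d -> discrete_topology A).
  exact: proj_continuous.
move/continuousP : pc => /(_ [set a]); apply; exact: discrete_open.
Qed.

(** Induction on [m]: the new constraint is one open coordinate condition, or none when [m] is not
    the code of a site. *)
Lemma agree_nbhs m (x : X) : nbhs x [set y | agree m x y].
Proof.
elim: m => [|m IHm]; first by apply: filterS filterT => y _ j.
case E : (@unpickle 'rV[int]_d m) => [j|]; last first.
  apply: filterS IHm => y xy j; rewrite ltnS leq_eqVlt => /orP[/eqP jm|/xy//].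
  by rewrite -jm pickleK in E.
have := open_nbhs_nbhs (conj (@open_coord j (set_val x j)) erefl).
move=> /(filterI IHm); apply: filterS => y [xy xyj] j'.
rewrite ltnS leq_eqVlt => /orP[/eqP jm|/xy//].
by move: E; rewrite -jm pickleK => -[->].
Qed.

Lemma compact_subshift : compact [set: X].
Proof.
have cX : compact (X : set (config A d)).
  have cT : compact
      [set f : config A d | forall i, [set: discrete_topology A] (f i)].
    apply: (@tychonoff _ (fun=> discrete_topology A) (fun=> setT)) => _.
    by apply: finite_compact; exact: finite_finset.
  by apply: subclosed_compact cT _; [exact: subshift_closed|].
(* From the closed set to the sigma type: a filter on [X] is pushed to the full shift, and its
   cluster point there is lifted back. *)
move=> F PF FT.
have FX : (set_val @ F) (X : set (config A d)).
  by apply: (@filterS _ F _ setT) => // x _; exact: set_valP.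
have [y [Xy Fy]] := cX (set_val @ F) _ FX.
exists (SigSub (mem_set Xy)); split=> // B V FB [/= W [[W' oW' <-] W'y] WV].
have FsB : (set_val @ F) (set_val @` B).
  by apply: (@filterS _ F _ B) => // x Bx; exists x.
have [_ [[x Bx <-] W'x]] := Fy _ _ FsB (open_nbhs_nbhs (conj oW' W'y)).
by exists x; split => //; apply: WV.
Qed.

(** Compactness in near-covering form turns the [m] that continuity gives at each point into a
    single [m]. *)
Lemma unif_continuous_agree (R : realType) (f : X -> R) (e : R) :
  continuous f -> 0 < e ->
  exists m, forall x y, agree m x y -> `|f x - f y| < e.
Proof.
move=> fc e0.
have /compact_near_coveringP := compact_subshift.
move=> /(_ nat \oo (fun m x => forall y, agree m x y -> `|f x - f y| < e)).
case=> [x _|m _ mP]; last by exists m => x y; apply: (mP m) => /=.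
have e20 : 0 < e / 2 by rewrite divr_gt0.
have /cvgrPdist_lt /(_ _ e20) /agree_sub_nbhs[m mf] := fc x.
exists ([set y | agree m x y], [set n | (m <= n)%N]).
  by split; [exact: agree_nbhs|exists m].
move=> [y n] /= [xy mn] z yz.
have xz : agree m x z by move=> j jm; rewrite xy// (agree_le mn yz).
rewrite (splitr e) (le_lt_trans (ler_distD (f x) _ _))// ltrD//.
  by rewrite distrC mf.
exact: mf.
Qed.

Lemma bounded_continuous_subshift (R : realType) (f : X -> R) :
  continuous f -> exists2 B, 0 <= B & forall x, `|f x| <= B.
Proof.
move=> fc; have /compact_bounded [M [Mr MB]] : compact (f @` [set: X]).
  by apply: continuous_compact compact_subshift; exact: continuous_subspaceT.
exists (`|M| + 1) => [|x]; first by rewrite addr_ge0.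
by apply: MB; [rewrite (le_lt_trans (ler_norm M))// ltrDl|exists x].
Qed.

End subshift_topology.

(** * Measurability *)

Section subshift_measurability.
Context (A : finType) (d : nat) (X : subshift A d) (X0 : X !=set0).

Lemma measurable_open (U : set X) : open U -> measurable (U : set (borel X0)).
Proof. by move=> oU; exact: sub_sigma_algebra. Qed.

Lemma measurable_coord j a :
  measurable ([set x : X | set_val x j = a] : set (borel X0)).
Proof. by apply: measurable_open; exact: open_coord. Qed.

Lemma measurable_fun_continuous (f : X -> X) : continuous f ->
  measurable_fun setT (f : borel X0 -> borel X0).
Proof.
move=> /continuousP cf.
apply: (@measurability _ _ _ (borel X0) setT _ (@open (psubshift X0))).
  by [].
by move=> _ [U oU <-]; rewrite setTI; apply: measurable_open; exact: cf.
Qed.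

Lemma measurable_fun_continuous_real (R : realType) (f : X -> R) :
  continuous f -> measurable_fun setT (f : borel X0 -> R).
Proof.
move=> /continuousP cf; apply: (measurability _ (RGenOpens.measurableE R)).
move=> _ [_ [a [b ->] <-]]; rewrite setTI.
by apply: measurable_open; apply: cf; exact: interval_open.
Qed.

(* The finitely supported cylinders are countably many and form a basis. *)
Lemma measurable_fun_coord d' (T : measurableType d') (g : T -> borel X0) :
  (forall j a, measurable [set t | set_val (g t : X) j = a]) ->
  measurable_fun setT g.
Proof.
move=> mg.
apply: (@measurability _ _ _ (borel X0) setT _ (@open (psubshift X0))).
  by [].
move=> _ [U oU <-]; rewrite setTI.
pose cyl (s : seq ('rV[int]_d * A)) : set X :=
  [set x | {in s, forall p, set_val x p.1 = p.2}].
have -> : U = \bigcup_(s in [set s | cyl s `<=` U]) cyl s.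
  apply/seteqP; split=> [x Ux|x [s sU xs]]; last exact: sU.
  have [m mU] := agree_sub_nbhs (open_nbhs_nbhs (conj oU Ux)).
  exists [seq (j, set_val (x : X) j) | j <- pmap unpickle (iota 0 m)];
    last by move=> _ /mapP[j _ ->].
  move=> y ys; apply: mU => j jm; apply/esym/(ys (j, set_val (x : X) j)).
  by apply/mapP; exists j => //; rewrite mem_pmap; apply/mapP;
    exists (pickle j); rewrite ?pickleK// mem_iota.
rewrite preimage_bigcup bigcup_mkcond.
apply: countable_bigcupT_measurable => // s; case: ifPn => // _.
elim: s => [|[j a] s IHs].
  by rewrite (_ : _ @^-1` _ = setT)//; apply/seteqP; split.
rewrite (_ : _ @^-1` _ = [set t | set_val (g t : X) j = a] `&` g @^-1` cyl s).
  exact: measurableI.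
apply/seteqP; split => [t ts|t [tj ts] p].
  split; first by rewrite /= (ts (j, a)) ?mem_head.
  by move=> p ps; apply: ts; rewrite in_cons ps orbT.
by rewrite in_cons => /orP[/eqP -> //|]; exact: ts.
Qed.

Lemma measurable_coord_eq (f g : borel X0 -> borel X0) j :
  measurable_fun setT f -> measurable_fun setT g ->
  measurable [set x | set_val (f x : X) j = set_val (g x : X) j].
Proof.
move=> mf mg.
rewrite (_ : [set _ | _] = \bigcup_a
  (f @^-1` [set x | set_val (x : X) j = a] `&`
   g @^-1` [set x | set_val (x : X) j = a])).
  apply: countable_bigcupT_measurable => [|a].
    by apply: finite_set_countable; exact: finite_finset.
  apply: measurableI; rewrite -[X in measurable X]setTI.
    by apply: mf => //; exact: measurable_coord.
  by apply: mg => //; exact: measurable_coord.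
apply/seteqP; split => [x xj|x [a _ [/= -> ->]]//].
by exists (set_val (g x : X) j).
Qed.

(** * Measurability of the sets of locally (eventually) periodic points *)

Section cellular_automaton.
Variable phi : X -> X.
Hypothesis cphi : continuous phi.

Lemma continuous_iter i : continuous (iter i phi).
Proof.
elim: i => [|i IHi] x; first exact: cvg_id.
have : {for x, continuous (phi \o iter i phi)}.
  by apply: continuous_comp; [exact: IHi|exact: cphi].
exact.
Qed.

Lemma measurable_fun_iter i :
  measurable_fun setT (iter i phi : borel X0 -> borel X0).
Proof. by apply: measurable_fun_continuous; exact: continuous_iter. Qed.

Lemma eventually_periodic_windowP m x :
  eventually_periodic (fun i => window_restr (m := m) (set_val (iter i phi x)))
  <-> exists N p, (0 < p)%N /\ forall i j, window d m j ->
    set_val (iter (N + (i + p)) phi x) j = set_val (iter (N + i) phi x) j.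
Proof.
split=> [[N [p p0 Np]]|[N [p [p0 Np]]]]; exists N; exists p => //.
  split => // i j jm; have := congr1 (fun w => w (SigSub (mem_set jm))) (Np i).
  by [].
by move=> i; apply/funext => j; apply: Np; exact: set_valP.
Qed.

Let measurable_window m i j : measurable
  (\bigcap_(c in window d m) [set x : X |
     set_val (iter i phi x) c = set_val (iter j phi x) c] : set (borel X0)).
Proof.
(* The complement is a union over sites, which form a countable type; sites outside the window
   contribute the empty set. *)
rewrite -[X in measurable X]setCK setC_bigcap bigcup_mkcond; apply: measurableC.
apply: countable_bigcupT_measurable => // c; case: ifPn => // _.
by apply: measurableC; apply: measurable_coord_eq; exact: measurable_fun_iter.
Qed.

Lemma measurable_LP : measurable (LP phi : set (borel X0)).
Proof.
rewrite (_ : LP phi = \bigcap_m \bigcup_(p in [set p | (0 < p)%N])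
  \bigcap_i \bigcap_(c in window d m)
    [set x : X | set_val (iter (i + p) phi x) c = set_val (iter i phi x) c]).
  apply: bigcapT_measurable => m; apply: bigcup_measurable => p _.
  by apply: bigcapT_measurable => i; exact: measurable_window.
apply/seteqP; split => [x xL m _|x xL m].
  have [p p0 xp] := xL m; exists p => // i _ c cm.
  exact: (congr1 (fun w => w (SigSub (mem_set cm))) (xp i)).
have [p p0 xp] := xL m I; exists p => // i; apply/funext => c.
by apply: xp => //; exact: set_valP.
Qed.

Lemma measurable_LEP : measurable (LEP phi : set (borel X0)).
Proof.
rewrite (_ : LEP phi = \bigcap_m \bigcup_N \bigcup_(p in [set p | (0 < p)%N])
  \bigcap_i \bigcap_(j in window d m)
    [set x : X | set_val (iter (N + (i + p)) phi x) j =
                 set_val (iter (N + i) phi x) j]).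
  apply: bigcapT_measurable => m; apply: bigcupT_measurable => N.
  apply: bigcup_measurable => p _; apply: bigcapT_measurable => i.
  exact: measurable_window.
apply/seteqP; split => [x xL m _|x xL m].
  have /eventually_periodic_windowP[N [p [p0 Np]]] := xL m.
  by exists N => //; exists p => // i _ j; exact: Np.
have [N _ [p p0 Np]] := xL m I.
by apply/eventually_periodic_windowP; exists N, p; split => // i j; exact: Np.
Qed.

End cellular_automaton.
End subshift_measurability.

(** * Averages of asymptotically almost periodic sequences *)

Section averages.
Context (R : realType) (u : nat -> R).

Definition average (a n : nat) : R := n%:R^-1 * \sum_(i < n) u (a + i)%N.

Section almost_period.
Context (B e : R) (N p : nat).
Hypothesis uB : forall i, `|u i| <= B.
Hypothesis e0 : 0 <= e.
Hypothesis p0 : (0 < p)%N.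
Hypothesis Np : forall i j, (N <= i)%N -> (N <= j)%N -> i = j %[mod p] ->
  `|u i - u j| <= e.

(** The candidate mean is taken over the first full period after [N]. *)
Let M := p%:R^-1 * \sum_(i < p) u (N + i)%N.

Let B0 : 0 <= B. Proof. exact: le_trans (uB 0%N). Qed.

Let pR : 0 < p%:R :> R. Proof. by rewrite ltr0n. Qed.

Let MB : `|M| <= B.
Proof.
rewrite normrM gtr0_norm ?invr_gt0// ler_pdivrMl//.
apply: le_trans (ler_norm_sum _ _ _) _.
rewrite mulr_natl -[X in _ *+ X]card_ord -sumr_const.
by apply: ler_sum => i _; exact: uB.
Qed.

(** A block of length [p] meets each residue modulo [p] once; [h] matches its terms with the
    congruent ones of the block starting at [N]. *)
Let sum_block a : (N <= a)%N ->
  `|\sum_(i < p) u (a + i)%N - p%:R * M| <= p%:R * e.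
Proof.
move=> Na; rewrite /M mulrA mulfV ?gt_eqF// mul1r.
pose h (i : 'I_p) : 'I_p := Ordinal (ltn_pmod (a - N + i) p0).
have hinj : injective h.
  move=> i j /(congr1 val)/= /eqP; rewrite eqn_modDl.
  by rewrite !modn_small// => /eqP/val_inj.
rewrite [X in _ - X](reindex_inj hinj) -sumrB.
apply: le_trans (ler_norm_sum _ _ _) _.
rewrite mulr_natl -[X in _ *+ X]card_ord -sumr_const; apply: ler_sum => i _.
apply: Np; rewrite ?leq_addr//= ?(leq_trans Na) ?leq_addr//.
by rewrite modnDmr addnA subnKC.
Qed.

(** Full periods are split off one by one, each with error [p * e]; the remainder, shorter than [p],
    costs at most [p * (B + B)]. *)
Let sum_far n a : (N <= a)%N ->
  `|\sum_(i < n) u (a + i)%N - n%:R * M| <= n%:R * e + p%:R * (B + B).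
Proof.
elim/ltn_ind: n a => n IHn a Na; have [np|pn] := ltnP n p.
  rewrite -[leLHS]add0r lerD// ?mulr_ge0//.
  rewrite (@le_trans _ _ (n%:R * (B + B)))//; last first.
    by rewrite ler_wpM2r ?addr_ge0// ler_nat ltnW.
  rewrite mulrDr (le_trans (ler_normB _ _))// lerD//; last first.
    by rewrite normrM ger0_norm// ler_wpM2l.
  apply: le_trans (ler_norm_sum _ _ _) _.
  rewrite mulr_natl -[X in _ *+ X]card_ord -sumr_const.
  by apply: ler_sum => i _; exact: uB.
have [k nE] : exists k, n = (p + k)%N by exists (n - p)%N; rewrite subnKC.
rewrite {}nE in IHn pn *; rewrite big_split_ord/= natrD !mulrDl opprD addrACA.
rewrite -[leRHS]addrA.
rewrite (le_trans (ler_normD _ _))// lerD//; first exact: sum_block.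
under eq_bigr do rewrite addnA.
apply: IHn; first by rewrite -[ltnLHS]add0n ltn_add2r.
by rewrite (leq_trans Na) ?leq_addr.
Qed.

(** Moving the block one step to the right drops its first term and gains a new last one. *)
Let sum_shift n a k :
  `|\sum_(i < n) u (a + i)%N - \sum_(i < n) u (k + a + i)%N| <= k%:R * (B + B).
Proof.
elim: k => [|k IHk]; first by rewrite subrr normr0 mul0r.
rewrite (le_trans (ler_distD (\sum_(i < n) u (k + a + i)%N) _ _))//.
rewrite -natr1 mulrDl mul1r lerD//.
have -> : \sum_(i < n) u (k + a + i)%N - \sum_(i < n) u (k.+1 + a + i)%N
    = u (k + a)%N - u (k + a + n)%N.
  apply/eqP; rewrite subr_eq addrAC -subr_eq opprK; apply/eqP.
  rewrite -(big_ord_recr n (fun i => u (k + a + i)%N)) big_ord_recl addn0.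
  by congr (_ + _); apply: eq_bigr => i _; rewrite /= addnS.
by rewrite (le_trans (ler_normB _ _))// lerD.
Qed.

(** Shifting the block by [N] puts it in the range of [sum_far], whatever [a] is; this makes the
    bound uniform in the position. *)
Lemma sum_almost_period : exists M, forall n a,
  `|\sum_(i < n) u (a + i)%N - n%:R * M| <= n%:R * e + (p + N)%:R * (B + B).
Proof.
exists M => n a.
rewrite (le_trans (ler_distD (\sum_(i < n) u (N + a + i)%N) _ _))//.
rewrite natrD mulrDl addrA [leRHS]addrC lerD//.
by rewrite sum_far// leq_addr.
Qed.

End almost_period.

Lemma average_le B a n : (forall i, `|u i| <= B) -> `|average a n| <= B.
Proof.
move=> uB; have B0 : 0 <= B by exact: le_trans (uB 0%N).
case: n => [|n]; first by rewrite /average big_ord0 mulr0 normr0.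
rewrite normrM gtr0_norm// ler_pdivrMl//.
apply: le_trans (ler_norm_sum _ _ _) _.
by rewrite mulr_natl -[X in _ *+ X]card_ord -sumr_const; exact: ler_sum.
Qed.

(** An asymptotic form of limit periodicity: up to [e], the tail depends only on the index modulo
    [p]. *)
Definition almost_periodic := forall e : R, 0 < e -> exists N p, (0 < p)%N /\
  forall i j, (N <= i)%N -> (N <= j)%N -> i = j %[mod p] -> `|u i - u j| <= e.

Context (B : R) (uB : forall i, `|u i| <= B) (uap : almost_periodic).

Let average_near (e : R) : 0 < e -> exists M n0, forall n a, (n0 <= n)%N ->
  `|average a n - M| <= e.
Proof.
move=> e0; have e20 : 0 < e / 2 by rewrite divr_gt0.
have [N [p [p0 Np]]] := uap e20.
have [M Mna] := sum_almost_period uB (ltW e20) p0 Np.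
pose K := (p + N)%:R * (B + B).
(* From this rank on, [K <= n * (e / 2)], so the boundary error is absorbed after division by
   [n]. *)
exists M, (Num.truncn (K / (e / 2))).+1 => n a nK.
have n0 : (0 < n)%N by apply: leq_trans nK.
have nR : 0 < n%:R :> R by rewrite ltr0n.
rewrite -(ler_pM2l nR) -{1}(gtr0_norm nR) -normrM mulrBr mulrA mulfV ?gt_eqF//.
rewrite mul1r (le_trans (Mna _ _))// [in leRHS](splitr e) [leRHS]mulrDr lerD//.
rewrite -ler_pdivrMr// ltW// (lt_le_trans (truncnS_gt _))//.
by rewrite ler_nat.
Qed.

(** The averages from 0 form a Cauchy sequence; those from [a n] are close to the same [M], hence
    share the limit. *)
Lemma average_cvg : exists L : R, forall a : nat -> nat,
  average (a n) n @[n --> \oo] --> L.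
Proof.
have cL : cvg (average 0%N n @[n --> \oo]).
  apply/cauchy_cvgP/cauchy_exP => e e0.
  have e20 : 0 < e / 2 by rewrite divr_gt0.
  have [M [n0 Mn0]] := average_near e20.
  exists M, n0 => // n /= nn0.
  rewrite /ball/= distrC (le_lt_trans (Mn0 _ _ nn0))//.
  by rewrite ltr_pdivrMr// ltr_pMr// ltr1n.
exists (lim (average 0%N n @[n --> \oo])) => a.
apply/cvgrPdist_le => e e0.
have e30 : 0 < e / 3 by rewrite divr_gt0.
have [M [n0 Mn0]] := average_near e30.
move/cvgrPdist_le : cL => /(_ _ e30); apply: filterS2 (nbhs_infty_ge n0).
move=> n nn0 Ln.
have := Mn0 n 0%N nn0; have := Mn0 n (a n) nn0.
move: Ln; rewrite !ler_norml => /andP[? ?] /andP[? ?] /andP[? ?].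
by apply/andP; split; lra.
Qed.

End averages.

(** * The odometer *)

(* [digits k] is a permutation of the integers below [k!] which turns the
   compatibility of the truncated expansions [Num.truncn (k! * t)] into a
   compatibility modulo [k!]. *)
Fixpoint digits (k q : nat) : nat :=
  if k is k'.+1 then (digits k' (q %/ k) + k'`! * (q %% k))%N else 0%N.

Lemma digits_lt k q : (q < k`!)%N -> (digits k q < k`!)%N.
Proof.
elim: k q => [|k IHk] q //= qk; rewrite factS in qk *.
have qk' : (q %/ k.+1 < k`!)%N by rewrite ltn_divLR// mulnC.
have := IHk _ qk'; have : (q %% k.+1 < k.+1)%N by rewrite ltn_pmod.
move: (digits _ _) (_ %% _)%N (k`!) => a b c; nia.
Qed.

(** The first summand of [digits k.+1 q] is below [k!], so division by [k!] with remainder recovers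
    both summands. *)
Lemma digits_inj k q r : (q < k`!)%N -> (r < k`!)%N ->
  digits k q = digits k r -> q = r.
Proof.
elim: k q r => [|k IHk] q r.
  by rewrite !fact0 !ltnS !leqn0 => /eqP-> /eqP->.
rewrite factS => qk rk /=.
have qk' : (q %/ k.+1 < k`!)%N by rewrite ltn_divLR// mulnC.
have rk' : (r %/ k.+1 < k`!)%N by rewrite ltn_divLR// mulnC.
move=> E; have Eq := congr1 (modn^~ k`!) E; have Ed := congr1 (divn^~ k`!) E.
move: Eq Ed; rewrite /= ![(digits k _ + _)%N]addnC ![(k`! * _)%N]mulnC.
rewrite !modnMDl !divnMDl ?fact_gt0//.
rewrite (modn_small (digits_lt qk')) (modn_small (digits_lt rk')).
rewrite (divn_small (digits_lt qk')) (divn_small (digits_lt rk')) !addn0.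
move=> /(IHk _ _ qk' rk') Eq Em.
by rewrite (divn_eq q k.+1) (divn_eq r k.+1) Eq Em.
Qed.

Lemma sum_digits (V : nmodType) k (F : nat -> V) :
  \sum_(q < k`!) F (digits k q) = \sum_(q < k`!) F q.
Proof.
pose h (q : 'I_(k`!)) : 'I_(k`!) := Ordinal (digits_lt (ltn_ord q)).
rewrite [RHS](reindex_inj (h := h))//.
by move=> q r /(congr1 val)/= /digits_inj E; apply: val_inj; exact: E.
Qed.

Section odometer.
Context (R : realType).

(** The integer n_k(t). For t in [0, 1) with Cantor expansion t = sum_j d_j / j!, it is the sum of
    (j-1)! d_j over 1 <= j <= k. *)
Definition odometer (k : nat) (t : R) : nat :=
  digits k (Num.truncn (k`!%:R * t)).

Lemma truncn_divn (m : nat) (x : R) : (0 < m)%N ->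
  (Num.truncn (m%:R * x) %/ m)%N = Num.truncn x.
Proof.
move=> m0; have mR : 0 < m%:R :> R by rewrite ltr0n.
(* [Num.truncn] sends negative reals to 0, so both sides vanish there. *)
have [x0|x0] := ltP x 0.
  have trunc0 (y : R) : y < 0 -> Num.truncn y = 0%N.
    by move=> y0; apply/eqP; rewrite -leqn0 truncn_le_nat (lt_trans y0).
  by rewrite !trunc0 ?div0n// nmulr_llt0.
apply/eqP; rewrite eq_sym truncn_eq//.
have /andP[h1 h2] := truncn_itv (mulr_ge0 (ltW mR) x0).
set q := Num.truncn _ in h1 h2 *.
rewrite -(ler_pM2l mR) -(ltr_pM2l mR) -!natrM; apply/andP; split.
  by rewrite (le_trans _ h1)// ler_nat mulnC leq_trunc_div.
by rewrite (lt_le_trans h2)// ler_nat mulnC ltn_ceil.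
Qed.

(** By [truncn_divn], each further level keeps the previous value and adds a multiple of a factorial
    that [k!] divides. *)
Lemma odometer_modn k l t : (k <= l)%N ->
  odometer l t = odometer k t %[mod k`!].
Proof.
move=> /subnKC <-; elim: (l - k)%N => [|n IHn]; first by rewrite addn0.
rewrite addnS -IHn /odometer /=.
rewrite [_`!%:R * t](_ : _ = (k + n).+1%:R * ((k + n)`!%:R * t)).
  rewrite truncn_divn// -modnDmr.
  have /dvdnP[c ->] : (k`! %| (k + n)`!)%N.
    by rewrite -(bin_fact (leq_addr n k)) dvdn_mull// dvdn_mulr.
  by rewrite mulnAC modnMl addn0.
by rewrite factS natrM mulrA.
Qed.

Lemma measurable_odometer k i : measurable [set t : R | odometer k t = i].
Proof.
pose I q := [set t : R | Num.truncn (k`!%:R * t) = q].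
rewrite (_ : [set _ | _] = \bigcup_(q in [set q | digits k q = i]) I q).
  apply: bigcup_measurable => q _; rewrite /I.
  (* Level sets are differences of sublevel sets, which are half-lines. *)
  have -> : [set t : R | Num.truncn (k`!%:R * t) = q] =
     [set t | (Num.truncn (k`!%:R * t) <= q)%N] `\`
     (if q is q'.+1 then [set t | (Num.truncn (k`!%:R * t) <= q')%N] else set0).
    apply/seteqP; split => t /=; case: q => [|q] /=.
    - by move=> ->; split.
    - by move=> ->; rewrite ltnn; split.
    - by move=> [+ _]; rewrite leqn0 => /eqP.
    - by rewrite leq_eqVlt ltnS => -[/orP[/eqP//|?] ?].
  have mle q' : measurable [set t : R | (Num.truncn (k`!%:R * t) <= q')%N].
    have kR : 0 < k`!%:R :> R by rewrite ltr0n fact_gt0.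
    rewrite (_ : [set _ | _] = `]-oo, q'.+1%:R / k`!%:R[%classic)//.
    apply/seteqP; split=> t /=;
      by rewrite in_itv/= truncn_le_nat ltr_pdivlMr// mulrC.
  by apply: measurableD => //; case: q.
apply/seteqP; split => [t /= ti|t [q /= qi tq]].
  by exists (Num.truncn (k`!%:R * t)).
by rewrite /odometer tq.
Qed.

End odometer.

(** * The law of the odometer under the uniform measure *)

Section odometer_law.
Context (R : realType).

Lemma measurable_fun_odometer k :
  measurable_fun setT (odometer k : R -> nat).
Proof.
move=> _ Y _; rewrite setTI.
rewrite (_ : _ @^-1` _ = \bigcup_(i in Y) [set t | odometer k t = i]).
  by apply: bigcup_measurable => i _; exact: measurable_odometer.
apply/seteqP; split => [t Yt|t [i Yi /= ti]]; first by exists (odometer k t).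
by rewrite /preimage/= ti.
Qed.

(** The truncation of [k! * t] equals [n] on a cell of length [1 / k!], and [digits] permutes the
    [k!] values. *)
Lemma integral_odometer k (h : nat -> R) : (forall i, 0 <= h i) ->
  (\int[uniform_prob (@ltr01 R)]_t (h (odometer k t))%:E =
   (k`!%:R^-1 * \sum_(i < k`!) h i)%:E)%E.
Proof.
move=> h0; have kR : 0 < k`!%:R :> R by rewrite ltr0n fact_gt0.
have mh : measurable_fun setT (fun t : R => (h (odometer k t))%:E : \bar R).
  apply/measurable_EFinP; apply: (measurableT_comp (f := h)) => //.
  exact: measurable_fun_odometer.
rewrite integral_uniform//; last by move=> t; rewrite lee_fin.
rewrite subr0 invr1 mul1e -integral_itv_bndo_bndc; last first.
  exact: measurable_funTS.
(* Cells are added one at a time; [n = k!] exhausts the unit interval. *)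
have main n : (\int[lebesgue_measure]_(t in `[0%R, (n%:R / k`!%:R)%R[)
    (h (odometer k t))%:E = (k`!%:R^-1 * \sum_(i < n) h (digits k i))%:E)%E.
  elim: n => [|n IHn].
    by rewrite mul0r set_itvxx integral_set0 big_ord0 mulr0.
  have nn : n%:R / k`!%:R <= n.+1%:R / k`!%:R :> R.
    by rewrite ler_pM2r ?invr_gt0// ler_nat.
  have -> : `[0, n.+1%:R / k`!%:R[%classic =
     `[0, n%:R / k`!%:R[ `|` `[n%:R / k`!%:R, n.+1%:R / k`!%:R[ :> set R.
    by apply: itv_bndbnd_setU; rewrite bnd_simp ?divr_ge0.
  rewrite ge0_integral_setU//=; last 3 first.
  - exact: measurable_funTS.
  - by move=> t _; rewrite lee_fin.
  - apply/disj_setPS => t [/=]; rewrite !in_itv/= => /andP[_ h1] /andP[h2 _].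
    by move: (lt_le_trans h1 h2); rewrite ltxx.
  rewrite IHn (eq_integral (cst (h (digits k n))%:E)); last first.
    move=> t; rewrite inE/= in_itv/= => /andP[h1 h2].
    rewrite /odometer (_ : Num.truncn _ = n)//; apply: truncn_def.
    by rewrite mulrC -ler_pdivrMr// -ltr_pdivlMr// h1 h2.
  rewrite integral_cst//= lebesgue_measure_itv/= lte_fin.
  rewrite ltr_pM2r ?invr_gt0// ltr_nat ltnSn.
  rewrite -EFinB -EFinM -EFinD big_ord_recr/=.
  congr (_%:E); rewrite [RHS]mulrDr; congr (_ + _).
  by rewrite -mulrBl -natr1 addrAC subrr add0r mul1r mulrC.
rewrite -(sum_digits k h) -main.
by rewrite mulfV ?gt_eqF.
Qed.

End odometer_law.

(** * Limit points of orbits *)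

Section orbits.
Context (R : realType) (A : finType) (d : nat) (X : subshift A d).
Variable phi : X -> X.
Hypothesis cphi : continuous phi.

Lemma window_pickle m :
  exists M, forall j : 'rV[int]_d, (pickle j < m)%N -> window d M j.
Proof.
elim: m => [|m [M HM]]; first by exists 0%N.
(* The site of code [m], or 0 if there is none; enlarging the window by the sum of its absolute
   coordinates makes room for it. *)
pose j0 := odflt 0 (@unpickle 'rV[int]_d m).
exists (M + \sum_k absz (j0 ord0 k))%N => j.
rewrite ltnS leq_eqVlt => /orP[/eqP jm|jm].
  move=> k; have <- : j0 = j by rewrite /j0 -jm pickleK.
  by rewrite -abszE lez_nat (bigD1 k)//=; lia.
by move=> k; have := HM _ jm k; rewrite -abszE !lez_nat; lia.
Qed.

(** Iterating the period shows that past [N] the window content depends only on the time modulo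
    [p]. *)
Lemma LEP_window x m : LEP phi x -> exists N p, (0 < p)%N /\
  forall i j, (N <= i)%N -> (N <= j)%N -> i = j %[mod p] ->
  forall c, window d m c -> set_val (iter i phi x) c = set_val (iter j phi x) c.
Proof.
move=> /(_ m)/eventually_periodic_windowP[N [p [p0 Np]]].
have NpS c n i : window d m c -> (N <= i)%N ->
    set_val (iter (i + n * p) phi x) c = set_val (iter i phi x) c.
  move=> cm Ni; elim: n => [|n <-]; first by rewrite mul0n addn0.
  have := Np (i - N + n * p)%N c cm.
  have -> // : (N + (i - N + n * p + p) = i + n.+1 * p)%N by rewrite mulSn; lia.
  have -> // : (N + (i - N + n * p) = i + n * p)%N by lia.
exists N, p; split => // i j Ni Nj.
wlog ij : i j Ni Nj / (i <= j)%N => [W ijp c cm|].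
  by case: (leqP i j) => [|/ltnW] ij; [|apply/esym]; apply: (W _ _ _ _ ij).
move=> /eqP ijp c cm; apply/esym.
have /dvdnP[n jiE] : (p %| j - i)%N by rewrite -eqn_mod_dvd// eq_sym.
by rewrite -(subnKC ij) jiE NpS.
Qed.

Lemma LEP_agree x m : LEP phi x -> exists N p, (0 < p)%N /\
  forall i j, (N <= i)%N -> (N <= j)%N -> i = j %[mod p] ->
  agree m (iter i phi x) (iter j phi x).
Proof.
have [M HM] := window_pickle m.
move=> /(LEP_window M)[N [p [p0 Np]]]; exists N, p.
split => // i j Ni Nj ij c cm.
by apply: Np => //; exact: HM.
Qed.

(** Up to [e], [f] is determined by finitely many coordinates, whose contents along the orbit are
    eventually periodic. *)
Lemma LEP_almost_periodic x (f : X -> R) : LEP phi x -> continuous f ->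
  almost_periodic (fun i => f (iter i phi x)).
Proof.
move=> xL cf e e0; have [m mf] := unif_continuous_agree cf e0.
have [N [p [p0 Np]]] := LEP_agree m xL.
by exists N, p; split => // i j Ni Nj ij; apply/ltW/mf/Np.
Qed.

(** Adding [k!] pushes the time past any preperiod without changing its residue modulo any positive
    [p <= k]. *)
Definition orbit_time (k : nat) (t : R) : nat := (k`! + odometer k t)%N.

Definition orbit_map (k : nat) (z : X * R) : X :=
  iter (orbit_time k z.2) phi z.1.

Lemma orbit_time_mod p k l t : (0 < p)%N -> (p <= k)%N -> (k <= l)%N ->
  orbit_time l t = orbit_time k t %[mod p].
Proof.
move=> p0 pk kl; have dvd_fact n : (p <= n)%N -> (p %| n`!)%N.
  by move=> pn; apply: dvdn_fact; rewrite p0.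
rewrite /orbit_time -modnDml (eqP (dvd_fact _ (leq_trans pk kl))) add0n.
rewrite -[RHS]modnDml (eqP (dvd_fact _ pk)) add0n.
rewrite -(modn_dvdm (odometer l t) (dvd_fact _ pk)) odometer_modn//.
by rewrite modn_dvdm ?dvd_fact.
Qed.

(** For [k >= N] the time exceeds the preperiod, as [k <= k!]; for [k >= p] its residue modulo [p]
    is frozen. *)
Lemma orbit_map_stable x t m : LEP phi x -> exists K, forall k l,
  (K <= k)%N -> (k <= l)%N -> agree m (orbit_map l (x, t)) (orbit_map k (x, t)).
Proof.
move=> /(LEP_agree m)[N [p [p0 Np]]]; exists (maxn N p) => k l.
rewrite geq_max => /andP[Nk pk] kl; apply: Np => /=.
- by rewrite (leq_trans (leq_trans Nk kl))// (leq_trans (fact_geq l)) ?leq_addr.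
- by rewrite (leq_trans Nk)// (leq_trans (fact_geq k)) ?leq_addr.
- exact: orbit_time_mod.
Qed.

(** Compactness yields a cluster point, and stability of every finite set of coordinates makes it
    the limit. *)
Lemma orbit_map_cvg x t : LEP phi x ->
  exists y : X, orbit_map k (x, t) @[k --> \oo] --> y.
Proof.
move=> xL.
have [y [_ cy]] := compact_subshift (F := orbit_map k (x, t) @[k --> \oo])
  _ filterT.
exists y => U /agree_sub_nbhs[m mU].
have [K HK] := orbit_map_stable t m xL.
have EK : (orbit_map k (x, t) @[k --> \oo])
    [set orbit_map k (x, t) | k in [set k | (K <= k)%N]].
  by exists K => // k Kk; exists k.
have [_ [[k /= Kk <-] yk]] := cy _ _ EK (agree_nbhs m y).
exists k => // l /= kl; apply: mU => c cm.
by rewrite yk// (HK _ _ Kk kl).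
Qed.

(** Off [LEP phi] the default [z.1] keeps the map total and measurable. *)
Definition orbit_lim (z : X * R) : X :=
  if pselect (LEP phi z.1) is left zL then projT1 (cid (orbit_map_cvg z.2 zL))
  else z.1.

Lemma orbit_limP z : LEP phi z.1 -> orbit_map k z @[k --> \oo] --> orbit_lim z.
Proof.
rewrite /orbit_lim; case: pselect => // zL _; case: cid => y /=.
by case: z zL.
Qed.

Lemma orbit_lim_agree z m : LEP phi z.1 ->
  exists K, forall k, (K <= k)%N -> agree m (orbit_lim z) (orbit_map k z).
Proof.
by move=> /orbit_limP/(_ _ (agree_nbhs m _))[K _ HK]; exists K => k /HK.
Qed.

(** By continuity of the iterates, each site of the orbit of the limit is read off the orbit of
    [z.1] at a late time, where period [p] already holds; no preperiod survives. *)
Lemma orbit_lim_LP z : LEP phi z.1 -> LP phi (orbit_lim z).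
Proof.
move=> zL m; have [N [p [p0 Np]]] := LEP_window m zL.
exists p => // i; apply/funext => c; have cm := set_valP c.
have lim_c n : exists K, forall k, (K <= k)%N ->
    set_val (iter n phi (orbit_lim z)) (set_val c) =
    set_val (iter (n + orbit_time k z.2) phi z.1) (set_val c).
  have /continuous_iter /(_ n (orbit_lim z)) cn := cphi.
  have := cvg_comp _ _ (orbit_limP zL) cn.
  move=> /(_ _ (agree_nbhs (pickle (set_val c)).+1 _))[K _ HK].
  by exists K => k /HK /(_ (set_val c) (ltnSn _)) ->; rewrite iterD.
have [K1 HK1] := lim_c i; have [K2 HK2] := lim_c (i + p)%N.
(* Large enough for both approximations, and for [orbit_time k] to reach [N]. *)
pose k := (K1 + K2 + N)%N.
rewrite /window_restr (HK1 k) ?(HK2 k) ?/k; [|lia|lia].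
have Nk : (N <= orbit_time k z.2)%N.
  rewrite (leq_trans _ (leq_addr _ _))// (leq_trans _ (fact_geq _))//.
  by rewrite /k leq_addl.
by apply: Np => //; rewrite ?(leq_trans Nk) ?leq_addl// addnAC modnDr.
Qed.

End orbits.

(** * The limit measure *)

Section limit_measure.
Context (R : realType) (A : finType) (d : nat) (X : subshift A d).
Context (X0 : X !=set0) (phi : X -> X).
Hypothesis cphi : continuous phi.
Variable mu : probability (borel X0) R.
Hypothesis muL : measure_LEP phi mu.

Local Notation unif := (uniform_prob (@ltr01 R)).
Local Notation Z := (borel X0 * measurableTypeR R)%type.

Let mL : measurable (LEP phi : set (borel X0)).
Proof. exact: measurable_LEP. Qed.

Lemma ae_LEP : {ae mu, forall x, LEP phi x}.
Proof.
exists (~` LEP phi); split => //; first exact: measurableC.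
by rewrite probability_setC// muL subee.
Qed.

Lemma ae_LEP_prod : {ae (mu \x unif)%E, forall z : Z, LEP phi z.1}.
Proof.
exists (~` LEP phi `*` setT); split => [||z zL]; last by split.
  by apply: measurableX => //; exact: measurableC.
rewrite product_measure1E//=; last exact: measurableC.
by rewrite probability_setC// muL subee// mul0e.
Qed.

(** Splitting by the value of the odometer gives a countable union of measurable rectangles. *)
Lemma measurable_fun_orbit_map k :
  measurable_fun setT (orbit_map phi k : Z -> borel X0).
Proof.
apply: measurable_fun_coord => j a.
rewrite (_ : [set _ | _] = \bigcup_i
  ((iter (k`! + i) phi : borel X0 -> borel X0) @^-1`
     [set x | set_val (x : X) j = a] `*` [set t : R | odometer k t = i])).
  apply: bigcupT_measurable => i; apply: measurableX.
    rewrite -[X in measurable X]setTI; apply: measurable_fun_iter => //.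
    exact: measurable_coord.
  exact: measurable_odometer.
apply/seteqP; split => [z za|z [i _ [/= za zi]]].
  by exists (odometer k z.2).
by rewrite /orbit_map /orbit_time zi.
Qed.

(** Over [LEP phi], a coordinate of the limit equals [a] exactly when it does so along
    [orbit_map phi k] for all large [k]: a lower limit of measurable sets. *)
Lemma measurable_fun_orbit_lim :
  measurable_fun setT (orbit_lim phi : Z -> borel X0).
Proof.
apply: measurable_fun_coord => j a.
pose T k : set Z := [set z | set_val (orbit_map phi k z) j = a].
rewrite (_ : [set _ | _] =
  ((LEP phi `*` setT) `&` \bigcup_K \bigcap_(k in [set k | (K <= k)%N]) T k) `|`
  ((~` LEP phi `&` [set x | set_val (x : X) j = a]) `*` setT)).
  apply: measurableU; last first.
    apply: measurableX => //; apply: measurableI; first exact: measurableC.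
    exact: measurable_coord.
  apply: measurableI; first by apply: measurableX.
  apply: bigcupT_measurable => K; apply: bigcap_measurableType => k _.
  rewrite -[X in measurable X]setTI.
  exact: (measurable_fun_orbit_map k measurableT
    (measurable_coord (X0:=X0) j a)).
apply/seteqP; split => z /=.
  have [zL za|zL] := pselect (LEP phi z.1); last first.
    by rewrite /orbit_lim; case: pselect => // _ za; right.
  left; split => //; have [K HK] := orbit_lim_agree (pickle j).+1 zL.
  by exists K => // k Kk; rewrite /T/= -HK.
case=> [[[zL _] [K _ HK]]|[[zL za] _]]; last first.
  by rewrite /orbit_lim; case: pselect.
have [K' HK'] := orbit_lim_agree (pickle j).+1 zL.
rewrite (HK' (maxn K K')) ?leq_maxr//.
by apply: (HK (maxn K K')); rewrite /= leq_maxl.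
Qed.

Definition orbit_lim_mfun : {mfun Z >-> borel X0} :=
  mfun_Sub (mem_set measurable_fun_orbit_lim).

Definition limit_measure : probability (borel X0) R :=
  distribution (mu \x unif)%E orbit_lim_mfun.

Definition iter_mfun i : {mfun borel X0 >-> borel X0} :=
  mfun_Sub (mem_set (measurable_fun_iter cphi i)).

(** The Cesaro mean rebuilt as a bundled measure, so that integration lemmas apply; [i.+1] turns the
    range 1..n into indices below [n]. *)
Definition cesaro (n : nat) : {measure set (borel X0) -> \bar R} :=
  mscale (n%:R^-1)%:nng (msum (fun i => distribution mu (iter_mfun i.+1)) n).

Lemma cesaroE n : cesaro_measure phi mu n = cesaro n.
Proof.
apply/funext => B; rewrite /cesaro_measure big_add1/= big_mkord.
by [].
Qed.

(** * Integrals of a continuous test function *)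

Section test_function.
Variable f : X -> R.
Hypothesis cf : continuous f.

Local Notation orbit x := (fun i => f (iter i phi x)).

Lemma measurable_average a n :
  measurable_fun setT (fun x : borel X0 => average (orbit x) a n).
Proof.
apply: measurable_funM => //; apply: measurable_sum => i.
apply: (measurableT_comp (f := f : borel X0 -> R)).
  exact: measurable_fun_continuous_real.
exact: measurable_fun_iter.
Qed.

(** The pointwise limit on [LEP phi] does not depend on [a], so dominated convergence gives one [l]
    for all starting points. *)
Lemma average_integral_cvg : exists l : R, forall a : nat -> nat,
  (\int[mu]_x (average (orbit x) (a n) n)%:E)%E @[n --> \oo] --> l%:E.
Proof.
have [B B0 fB] := bounded_continuous_subshift cf.
(* An upper limit is measurable everywhere, and it is the true limit on [LEP phi]. *)
pose F (x : borel X0) : \bar R :=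
  limn_esup (fun n => (average (orbit x) 0 n)%:E).
have mF : measurable_fun setT F.
  apply: measurable_fun_limn_esup => n; apply/measurable_EFinP.
  exact: measurable_average.
have FE x : LEP phi x -> forall a : nat -> nat,
    (average (orbit x) (a n) n)%:E @[n --> \oo] --> F x.
  move=> xL a.
  have [L HL] := average_cvg (fun i => fB _) (LEP_almost_periodic xL cf).
  rewrite (_ : F x = L%:E); first by apply: cvg_EFin; [exact: nearW|exact: HL].
  rewrite /F limn_esup_lim; apply/cvg_lim => //; apply: cvg_esups.
  by apply: cvg_EFin; [exact: nearW|exact: (HL (fun=> 0%N))].
have dom a := @dominated_convergence _ _ _ mu setT measurableT
  (fun n x => (average (orbit x) (a n) n)%:E) F (cst B%:E).
have muF a : mu.-integrable setT F /\
    (\int[mu]_x (average (orbit x) (a n) n)%:E)%E @[n --> \oo] -->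
      (\int[mu]_x F x)%E.
  case: (dom a) => //.
  - by move=> n; apply/measurable_EFinP; exact: measurable_average.
  - have [N [mN N0 sN]] := ae_LEP; exists N; split => // x /= xn.
    by apply: sN => xL; apply: xn => _; exact: FE.
  - exact: finite_measure_integrable_cst.
  - by apply: aeW => x n _; rewrite lee_fin; exact: average_le.
have [iF _] := muF (fun=> 0%N).
exists (fine (\int[mu]_x F x)) => a; rewrite fineK; first by case: (muF a).
exact: integrable_fin_num.
Qed.

Lemma integral_orbit_lim_cvg :
  (\int[(mu \x unif)%E]_z (f (orbit_map phi k z))%:E)%E @[k --> \oo] -->
  (\int[(mu \x unif)%E]_z (f (orbit_lim phi z))%:E)%E.
Proof.
have [B B0 fB] := bounded_continuous_subshift cf.
have mf := measurable_fun_continuous_real (X0 := X0) cf.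
have [] // := @dominated_convergence _ _ _ (mu \x unif)%E setT measurableT
  (fun k z => (f (orbit_map phi k z))%:E) (fun z => (f (orbit_lim phi z))%:E)
  (cst B%:E).
- move=> k; apply/measurable_EFinP; apply: (measurableT_comp mf).
  exact: measurable_fun_orbit_map.
- apply/measurable_EFinP; apply: (measurableT_comp mf).
  exact: measurable_fun_orbit_lim.
- have [N [mN N0 sN]] := ae_LEP_prod; exists N; split => // z /= zn.
  apply: sN => zL; apply: zn => _; apply: cvg_EFin; first exact: nearW.
  by apply: cvg_comp (orbit_limP zL) _; exact: cf.
- exact: (finite_measure_integrable_cst ((mu \x unif)%E : probability Z R)).
- by apply: aeW => z k _; rewrite lee_fin.
Qed.

Hypothesis f0 : forall x, 0 <= f x.

(** By Tonelli, [x] may be fixed; the time is then uniform on the block from [k!] to [2 k! - 1]. *)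
Lemma integral_orbit_map k :
  (\int[(mu \x unif)%E]_z (f (orbit_map phi k z))%:E =
   \int[mu]_x (average (orbit x) k`! k`!)%:E)%E.
Proof.
rewrite fubini_tonelli1//=; last 2 first.
- apply/measurable_EFinP.
  apply: (measurableT_comp (measurable_fun_continuous_real (X0 := X0) cf)).
  exact: measurable_fun_orbit_map.
- by move=> z; rewrite lee_fin.
apply: eq_integral => x _.
exact: (@integral_odometer R k (fun i => f (iter (k`! + i) phi x))).
Qed.

Lemma integral_cesaro n :
  (\int[cesaro_measure phi mu n]_x (f x)%:E =
   \int[mu]_x (average (orbit x) 1 n)%:E)%E.
Proof.
have mf : measurable_fun setT (fun x : borel X0 => (f x)%:E).
  apply/measurable_EFinP; exact: measurable_fun_continuous_real.
have mfi i : measurable_fun setT (fun x : borel X0 => (f (iter i phi x))%:E).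
  exact: (measurableT_comp mf (measurable_fun_iter cphi i)).
rewrite cesaroE ge0_integral_mscale//; last by move=> x _; rewrite lee_fin.
rewrite ge0_integral_measure_sum//; last by move=> x _; rewrite lee_fin.
under [RHS]eq_integral do rewrite EFinM -sumEFin.
rewrite ge0_integralZl//; last 2 first.
- by apply: emeasurable_sum => i _; exact: mfi.
- by move=> x _; apply: sume_ge0 => i _; rewrite lee_fin.
rewrite ge0_integral_sum//; last by move=> i x _; rewrite lee_fin.
congr (_ * _)%E; apply: eq_bigr => i _.
by rewrite ge0_integral_pushforward//; move=> x _; rewrite lee_fin.
Qed.

(** Both sides are limits of integrated averages: blocks starting at 1 for the Cesaro means, blocks
    starting at their own length [k!] for the limit measure. *)
Lemma ge0_weak_cvg : exists2 l : R,
  (\int[cesaro_measure phi mu n]_x (f x)%:E)%E @[n --> \oo] --> l%:E &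
  (\int[limit_measure]_x (f x)%:E)%E = l%:E.
Proof.
have [l Hl] := average_integral_cvg; exists l.
  under eq_fun do rewrite integral_cesaro.
  exact: (Hl (fun=> 1%N)).
rewrite ge0_integral_pushforward//; last 2 first.
- apply/measurable_EFinP; exact: measurable_fun_continuous_real.
- by move=> x _; rewrite lee_fin.
have cl := integral_orbit_lim_cvg.
rewrite (funext integral_orbit_map) in cl.
have factoo : k`! @[k --> \oo] --> \oo.
  move=> U [N _ NU]; exists N => // k /= Nk.
  by apply: NU; exact: leq_trans (fact_geq k).
have lk := cvg_comp _ _ factoo (Hl id).
rewrite preimage_setT; exact: cvg_unique cl lk.
Qed.

End test_function.

Lemma weak_cvg_limit_measure : weak_cvg (cesaro_measure phi mu) limit_measure.
Proof.
move=> f cf.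
have pos (g : X -> R) : continuous g -> continuous (fun x => Num.max (g x) 0).
  by move=> cg x; apply: continuous_max; [exact: cg|exact: cst_continuous].
have cNf : continuous (fun x => - f x).
  by move=> x; apply: continuousN; exact: cf.
have max0 (g : X -> R) x : 0 <= Num.max (g x) 0 by rewrite le_max lexx orbT.
(* The nonnegative case is applied to the positive and negative parts of [f]; both limits are
   finite, so they can be subtracted. *)
have [l1 l1c l1E] := ge0_weak_cvg (pos _ cf) (max0 f).
have [l2 l2c l2E] := ge0_weak_cvg (pos _ cNf) (max0 (fun x => - f x)).
have E (m : {measure set (borel X0) -> \bar R}) :
  (\int[m]_x (f x)%:E = \int[m]_x (Num.max (f x) 0)%:E -
   \int[m]_x (Num.max (- f x) 0)%:E)%E.
  rewrite integralE; congr (_ - _)%E; apply: eq_integral => x _.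
    by rewrite funeposE EFin_max.
  by rewrite funenegE EFin_max EFinN.
rewrite E l1E l2E.
under eq_fun do rewrite cesaroE E -!cesaroE.
exact: cvgeB.
Qed.

(** The preimage of [LP phi] under [orbit_lim] contains the rectangle over [LEP phi], which has full
    measure. *)
Lemma limit_measure_LP : measure_LP phi limit_measure.
Proof.
have mLP : measurable (LP phi : set (borel X0)) by exact: measurable_LP.
have mpre : measurable ((orbit_lim phi : Z -> borel X0) @^-1` LP phi).
  by rewrite -[X in measurable X]setTI; exact: measurable_fun_orbit_lim.
apply/eqP; rewrite eq_le probability_le1//=.
have <- : (mu \x unif)%E (LEP phi `*` setT : set Z) = 1%E.
  by rewrite product_measure1E//= probability_setT mule1.
apply: le_measure; rewrite ?inE//; first exact: measurableX.
by move=> z [zL _]; exact: orbit_lim_LP.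
Qed.

End limit_measure.

Theorem theorem3p7 (R : realType) (A : finType) (d : nat) (hd : (0 < d)%N)
    (X : subshift A d) (X0 : (X !=set0)%classic) (phi : X -> X)
    (hphi : cellular_automaton phi)
    (mu : probability (borel X0) R) (hmu : measure_LEP phi mu) :
  exists mu_infty : probability (borel X0) R,
    weak_cvg (cesaro_measure phi mu) mu_infty /\ measure_LP phi mu_infty.
Proof.
have [cphi _] := hphi.
exists (limit_measure cphi mu); split.
  exact: weak_cvg_limit_measure.
exact: limit_measure_LP.
Qed.
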